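(* Let $n>1$ be an odd squarefree integer with $m$ distinct prime factors. Then $T(n)\le (2/3)^m\, n < n$.
   Context: $\sigma(n)=\sum_{d\mid n} d$ is the sum-of-divisors function, $v_2(m)$ is the exponent of $2$ in $m$, and for an odd positive integer $n$, $T(n) := \sigma(n)/2^{v_2(\sigma(n))}$ is the odd part of $\sigma(n)$. *)

(* Defs.v *)
From mathcomp Require Import all_boot all_order all_algebra.
Set Implicit Arguments.
Unset Strict Implicit.
Unset Printing Implicit Defensive.

Definition sigma (n : nat) : nat := \sum_(d <- divisors n) d.

Definition v2 (m : nat) : nat := logn 2 m.

(* The quotient is exact: 2 ^ v2 k always divides k. *)
Definition T (n : nat) : nat := sigma n %/ 2 ^ v2 (sigma n).

Definition squarefree (n : nat) : Prop := forall d : nat, d ^ 2 %| n -> d = 1.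

(* Main.v *)
(* For an odd squarefree n, sigma n is the product of the p + 1 over the primes
   p dividing n.  Each factor p + 1 is even and at most 4p/3, so passing to the
   odd part divides by at least 2 per prime and leaves at most 2p/3. *)
Require Import Defs.
From mathcomp Require Import all_boot all_order all_algebra.
Import Order.TTheory GRing.Theory Num.Theory.
Local Open Scope ring_scope.

Lemma sigma1 : sigma 1 = 1%N.
Proof. by rewrite /sigma big_cons big_nil. Qed.

(** The divisors of [p * k] are those of [k] together with their multiples by [p]. The two lists are
    disjoint because [p] divides no divisor of [k], so the sum splits as [sigma k + p * sigma k]. *)
Lemma sigma_primeM (p k : nat) :
  prime p -> (0 < k)%N -> coprime p k -> sigma (p * k) = (p.+1 * sigma k)%N.
Proof.
move=> p_pr k_gt0 co_pk; have p_gt0 := prime_gt0 p_pr.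
have pN_dvd d : (d %| k)%N -> ~~ (p %| d)%N.
  by move=> dk; rewrite -prime_coprime // (coprime_dvdr dk).
have perm_divs : perm_eq (divisors (p * k))
    (divisors k ++ [seq (p * d)%N | d <- divisors k]).
  apply: uniq_perm; first exact: divisors_uniq.
    rewrite cat_uniq divisors_uniq map_inj_uniq ?divisors_uniq ?andbT /=.
      apply/hasPn => _ /mapP[d _ ->]; rewrite -dvdn_divisors //.
      by apply: contraL (dvdn_mulr d (dvdnn p)) => /pN_dvd.
    by move=> x y /eqP; rewrite eqn_pmul2l // => /eqP.
  move=> d; rewrite mem_cat -!dvdn_divisors ?muln_gt0 ?p_gt0 //.
  apply/idP/orP => [d_pk | [d_k | /mapP[e]]].
  (* If [p] divides [d], cancelling [p] leaves a divisor of [k]; otherwise [d] is coprime to [p] and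
     Gauss's lemma gives [d %| k]. *)
  - have [/dvdnP[e d_eq] | pNd] := boolP (p %| d)%N.
      right; apply/mapP; exists e; last by rewrite d_eq mulnC.
      by rewrite -dvdn_divisors // -(dvdn_pmul2l p_gt0) mulnC -d_eq.
    by left; rewrite -(@Gauss_dvdr d p) // coprime_sym prime_coprime.
  - exact: dvdn_mull.
  - by rewrite -dvdn_divisors // => e_k ->; rewrite dvdn_pmul2l.
by rewrite /sigma (perm_big _ perm_divs) big_cat big_map /= -big_distrr /= mulSn.
Qed.

Lemma coprime_prod_primes (p : nat) (s : seq nat) :
  prime p -> all prime s -> p \notin s -> coprime p (\prod_(q <- s) q)%N.
Proof.
move=> p_pr s_pr pNs; rewrite big_seq.
apply: (big_ind (coprime p)) => [|x y px py|q qs]; first exact: coprimen1.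
  by rewrite coprimeMr px.
rewrite prime_coprime // dvdn_prime2 ?(allP s_pr q qs) //.
by apply: contraNneq pNs => ->.
Qed.

Lemma sigma_prod_primes (s : seq nat) : uniq s -> all prime s ->
  sigma (\prod_(p <- s) p) = (\prod_(p <- s) p.+1)%N.
Proof.
elim: s => [|p s IHs] /=; first by rewrite !big_nil sigma1.
case/andP=> pNs s_uniq /andP[p_pr s_pr]; rewrite !big_cons -IHs //.
rewrite sigma_primeM ?coprime_prod_primes //.
by rewrite big_seq prodn_cond_gt0 // => q /(allP s_pr)/prime_gt0.
Qed.

Lemma squarefree_prod_primes (n : nat) : (0 < n)%N -> squarefree n ->
  (\prod_(p <- primes n) p)%N = n.
Proof.
move=> n_gt0 sqf_n; rewrite [RHS]prod_prime_decomp // prime_decompE big_map /=.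
rewrite !big_seq; apply: eq_bigr => p p_n.
have p_pr : prime p by move: p_n; rewrite mem_primes => /andP[].
suff -> : logn p n = 1%N by rewrite expn1.
apply/eqP; rewrite eqn_leq logn_gt0 p_n andbT leqNgt.
(* An exponent of at least 2 would give [p ^ 2 %| n], hence [p = 1]. *)
apply: contraL (prime_gt1 p_pr); rewrite -pfactor_dvdn // => /sqf_n ->.
by rewrite ltnn.
Qed.

(** Both bounds build up factor by factor; clearing denominators keeps the second one in [nat]. *)
Lemma prodS_bounds (s : seq nat) : all (fun p => odd p && (2 < p)%N) s ->
  (2 ^ size s %| \prod_(p <- s) p.+1)%N /\
  (3 ^ size s * \prod_(p <- s) p.+1 <= 4 ^ size s * \prod_(p <- s) p)%N.
Proof.
elim: s => [|p s IHs] /=; first by rewrite !big_nil.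
case/andP=> /andP[p_odd p_gt2] /IHs[dvd_s le_s].
rewrite !big_cons !expnS; split; first by rewrite dvdn_mul // dvdn2 /= p_odd.
rewrite mulnACA [leqRHS]mulnACA leq_mul //.
(* Cancelling [3 * p] from [3 + 3 * p <= p + 3 * p] leaves [3 <= p]. *)
by rewrite mulnS [leqRHS]mulSn leq_add2r.
Qed.

Lemma T_prime_bound (n : nat) : (0 < n)%N -> odd n -> squarefree n ->
  (3 ^ size (primes n) * T n <= 2 ^ size (primes n) * n)%N.
Proof.
move=> n_gt0 n_odd sqf_n; set m := size _.
have primes_odd : all (fun p => odd p && (2 < p)%N) (primes n).
  apply/allP => p; rewrite mem_primes => /and3P[p_pr _ p_n].
  have p_odd := dvdn_odd p_n n_odd.
  by rewrite p_odd odd_prime_gt2.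
have primes_pr : all prime (primes n).
  by apply/allP => p; rewrite mem_primes => /andP[].
have [] := prodS_bounds _ primes_odd.
rewrite -sigma_prod_primes ?primes_uniq // squarefree_prod_primes // -/m.
move=> dvd_sigma le_sigma.
have sigma_gt0 : (0 < sigma n)%N.
  rewrite -(squarefree_prod_primes n) // sigma_prod_primes ?primes_uniq //.
  by rewrite prodn_gt0.
(* Since [2 ^ m] divides [sigma n], [m] is at most [v2 (sigma n)], while [T n * 2 ^ v2 (sigma n)] is
   exactly [sigma n]. *)
have le_T : (2 ^ m * T n <= sigma n)%N.
  rewrite -[leqRHS](divnK (pfactor_dvdnn 2 (sigma n))).
  by rewrite mulnC leq_mul2l leq_exp2l // -pfactor_dvdn // dvd_sigma orbT.
(* Multiplying by [2 ^ m] turns the right side into [4 ^ m * n], so that [le_T] and [le_sigma] chain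
   through [3 ^ m * sigma n]. *)
rewrite -(@leq_pmul2l (2 ^ m)) ?expn_gt0 // mulnCA [leqRHS]mulnA -expnMn.
by apply: leq_trans le_sigma; rewrite leq_mul2l le_T orbT.
Qed.

Theorem corollary2p4 (n m : nat) (n_gt1 : (1 < n)%N) (n_odd : odd n)
    (n_sqfree : squarefree n) (n_primes : size (primes n) = m) :
  (T n)%:R <= (2%:R / 3%:R) ^+ m * n%:R :> rat /\
  (2%:R / 3%:R) ^+ m * n%:R < n%:R :> rat.
Proof.
have n_gt0 := ltnW n_gt1; split.
  rewrite expr_div_n mulrAC ler_pdivlMr ?exprn_gt0 // mulrC.
  by rewrite -!natrX -!natrM ler_nat -n_primes T_prime_bound.
(* Strictness needs a nonzero exponent: [n > 1] has at least one prime factor. *)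
rewrite gtr_pMl ?ltr0n // exprn_ilt1 // -n_primes size_eq0 primes_eq0.
by rewrite -leqNgt.
Qed.
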